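(* Let $\mathcal{G}$ be a groupoid, let $(\mathcal{N},p)$ be a group bundle over $\mathcal{G}^{(0)}$, and let $[L]$ be a $\mathcal{G}$-kernel. Then $\operatorname{Ext}(\mathcal{G},\mathcal{N})_{[L]}\neq\emptyset$ if and only if the characteristic class $\chi(L)\in H^3(\mathcal{G},Z(\mathcal{N}))_L$ is trivial.
   Context: Groupoids are purely algebraic (no topology). A groupoid $\mathcal{G}$ has unit space $\mathcal{G}^{(0)}\subseteq\mathcal{G}$ and range and source maps $r,s:\mathcal{G}\to\mathcal{G}^{(0)}$; $xy$ is defined iff $s(x)=r(y)$; $\mathcal{G}^{(n)}$ is the set of $n$-tuples with $s(x_i)=r(x_{i+1})$. A group bundle over $\mathcal{G}^{(0)}$ is a set $\mathcal{N}$ with a map $p:\mathcal{N}\to\mathcal{G}^{(0)}$ such that every fibre $N_u:=p^{-1}(u)$ is a group; identifying the identity $1_u$ of $N_u$ with $u$, $\mathcal{N}$ is a groupoid over $\mathcal{G}^{(0)}$ with $r=s=p$. Extensions. A groupoid extension of $\mathcal{G}$ by $\mathcal{N}$ is a surjective groupoid homomorphism $j:\mathcal{E}\to\mathcal{G}$, where $\mathcal{E}$ is a groupoid with unit space $\mathcal{G}^{(0)}$, $j$ is the identity on $\mathcal{G}^{(0)}$, and $\mathcal{N}=\ker(j):=\{e\in\mathcal{E}: j(e)\in\mathcal{G}^{(0)}\}$. Two extensions $j:\mathcal{E}\to\mathcal{G}$, $j':\mathcal{E}'\to\mathcal{G}$ are equivalent if there is a groupoid homomorphism $\phi:\mathcal{E}\to\mathcal{E}'$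 with $\phi|_{\mathcal{N}}=\mathrm{id}$ and $j'\circ\phi=j$. $\operatorname{Ext}(\mathcal{G},\mathcal{N})$ is the set of equivalence classes. Factor systems. $C^1(\mathcal{G},\operatorname{Iso}(\mathcal{N}))$ is the set of families of group isomorphisms $L_x:N_{s(x)}\to N_{r(x)}$, $x\in\mathcal{G}$, with $L_u=\mathrm{id}_{N_u}$ for $u\in\mathcal{G}^{(0)}$. $C^2(\mathcal{G},\mathcal{N})$ is the set of maps $\sigma:\mathcal{G}^{(2)}\to\mathcal{N}$ with $\sigma(x,y)\in N_{r(x)}$ and $\sigma(x,s(x))=\sigma(r(x),x)=r(x)$. A factor system for $(\mathcal{G},\mathcal{N})$ is a pair $(L,\sigma)$ satisfying the twisted action condition $L_xL_y(n)=\sigma(x,y)L_{xy}(n)\sigma(x,y)^{-1}$ for all $(x,y)\in\mathcal{G}^{(2)}$, $n\in N_{s(y)}$, and the twisted cocycle condition $\sigma(x,y)\sigma(xy,z)=L_x(\sigma(y,z))\sigma(x,yz)$ for all $(x,y,z)\in\mathcal{G}^{(3)}$. $\mathcal{N}\times_{(L,\sigma)}\mathcal{G}$ is the groupoid extension with underlying set $\{(n,x)\in\mathcal{N}\times\mathcal{G}: p(n)=r(x)\}$, source $s(x)$, range $r(x)$ (identifying $u$ with $(u,u)$), product $(n,x)(m,y)=(nL_x(m)\sigma(x,y),xy)$, inverse $(n,x)^{-1}=(\sigma(x^{-1},x)^{-1}L_{x^{-1}}(n^{-1}),x^{-1})$, projection $j(n,x)=x$, and $\mathcal{N}$ identified with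 $\ker j$ via $n\mapsto(n,p(n))$. Every extension of $\mathcal{G}$ by $\mathcal{N}$ is equivalent to one of this form. Kernels. $C^1(\mathcal{G},\mathcal{N})$ is the group of maps $h:\mathcal{G}\to\mathcal{N}$ with $h(x)\in N_{r(x)}$ and $h(u)=u$ for $u\in\mathcal{G}^{(0)}$; put $(h.L)_x(n)=h(x)L_x(n)h(x)^{-1}$. $L\in C^1(\mathcal{G},\operatorname{Iso}(\mathcal{N}))$ is outer if there is $\sigma\in C^2(\mathcal{G},\mathcal{N})$ such that $(L,\sigma)$ satisfies the twisted action condition. On outer elements, $L\sim L'$ iff $L'=h.L$ for some $h\in C^1(\mathcal{G},\mathcal{N})$; the class $[L]$ is called a $\mathcal{G}$-kernel. $\operatorname{Ext}(\mathcal{G},\mathcal{N})_{[L]}$ is the set of classes in $\operatorname{Ext}(\mathcal{G},\mathcal{N})$ corresponding to $[L]$, i.e. those containing some $\mathcal{N}\times_{(L',\sigma')}\mathcal{G}$ with $(L',\sigma')$ a factor system and $L'\sim L$. Cohomology. $Z(\mathcal{N}):=\bigcup_{u}Z(N_u)$; for outer $L$ the restrictions of the $L_x$ satisfy $L_xL_y=L_{xy}$ on $Z(\mathcal{N})$. An $n$-cochain ($n\ge1$) is a map $h:\mathcal{G}^{(n)}\to Z(\mathcal{N})$ with $h(x_1,\dots,x_n)\in Z(N_{r(x_1)})$ which takes identity values whenever some $x_i$ is a unit. Multiplicatively, $d^2_L(\rho)(x,y,z)=L_x(\rho(y,z))\rho(xy,z)^{-1}\rho(x,yz)\rho(x,y)^{-1}$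 and $d^3_L(\chi)(x,y,z,w)=L_x(\chi(y,z,w))\chi(xy,z,w)^{-1}\chi(x,yz,w)\chi(x,y,zw)^{-1}\chi(x,y,z)$. $H^3(\mathcal{G},Z(\mathcal{N}))_L=\ker d^3_L/\operatorname{im}d^2_L$. Characteristic class. For outer $L$ choose $\sigma\in C^2(\mathcal{G},\mathcal{N})$ such that $(L,\sigma)$ satisfies the twisted action condition and put $\chi_{(L,\sigma)}(x,y,z):=L_x(\sigma(y,z))\sigma(x,yz)\sigma(xy,z)^{-1}\sigma(x,y)^{-1}$. This is a 3-cocycle with values in $Z(\mathcal{N})$, and its class $\chi(L):=[\chi_{(L,\sigma)}]\in H^3(\mathcal{G},Z(\mathcal{N}))_L$ is independent of $\sigma$ and constant on $[L]$. *)

(* Defs.v *)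
From mathcomp Require Import all_boot.
From mathcomp Require Import boolp classical_sets.

Set Implicit Arguments.
Unset Strict Implicit.
Unset Printing Implicit Defensive.

Local Open Scope classical_set_scope.
Local Open Scope group_scope.

(* Conventions.  A groupoid over the unit space [U] is given by its family of
   hom-sets: [x : G u v] is an arrow with range r(x) = u and source s(x) = v.
   Hence [x ** y] typechecks exactly when s(x) = r(y), a dependent triple
   [x : G u v], [y : G v w], [z : G w t] is an element of G^(3), and the unit
   [u] of the groupoid is the arrow [gid u : G u u].
   A group bundle over [U] is its family of fibres [N : U -> groupType]; the
   identity 1_u of [N u] plays the role of the unit [u]. *)

Record groupoid (U : Type) := Groupoid {
  arrow :> U -> U -> Type;
  gid : forall u, arrow u u;
  gcomp : forall u v w, arrow u v -> arrow v w -> arrow u w;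
  ginv : forall u v, arrow u v -> arrow v u;
  gcompA : forall u v w t (x : arrow u v) (y : arrow v w) (z : arrow w t),
    gcomp x (gcomp y z) = gcomp (gcomp x y) z;
  gcomp1x : forall u v (x : arrow u v), gcomp (gid u) x = x;
  gcompx1 : forall u v (x : arrow u v), gcomp x (gid v) = x;
  gcompVx : forall u v (x : arrow u v), gcomp (ginv x) x = gid v;
  gcompxV : forall u v (x : arrow u v), gcomp x (ginv x) = gid u
}.

Arguments gid {U g} u.
Notation "x ** y" := (gcomp x y) (at level 40, left associativity).

(* Homomorphisms that are the identity on the common unit space. *)
Record groupoid_hom (U : Type) (E G : groupoid U) := GroupoidHom {
  ghom_fun :> forall u v, E u v -> G u v;
  ghom1 : forall u, ghom_fun (gid u) = gid u;
  ghomM : forall u v w (e : E u v) (f : E v w),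
    ghom_fun (e ** f) = ghom_fun e ** ghom_fun f
}.

(* [ext_incl] is the identification of the bundle [N] with ker j; an arrow of
   [E] mapped to a unit has equal range and source, so ker j lies in the
   isotropy. *)
Record extension (U : Type) (G : groupoid U) (N : U -> groupType) := Extension {
  ext_gpd :> groupoid U;
  ext_proj : groupoid_hom ext_gpd G;
  ext_proj_surj : forall u v (x : G u v), exists e, ext_proj u v e = x;
  ext_incl : forall u, N u -> ext_gpd u u;
  ext_inclM : forall u (n m : N u),
    ext_incl (n * m) = ext_incl n ** ext_incl m;
  ext_incl_inj : forall u, injective (@ext_incl u);
  ext_ker : forall u (e : ext_gpd u u),
    ext_proj u u e = gid u <-> exists n, ext_incl n = e
}.

Definition ext_equiv (U : Type) (G : groupoid U) (N : U -> groupType)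
    (E E' : extension G N) : Prop :=
  exists phi : groupoid_hom E E',
    (forall u (n : N u), phi u u (ext_incl E n) = ext_incl E' n) /\
    (forall u v (e : E u v), ext_proj E' u v (phi u v e) = ext_proj E u v e).

(* The set of equivalence classes.  Sets of extensions are predicates because
   [extension G N] lives in a universe too large for [set]. *)
Definition Ext (U : Type) (G : groupoid U) (N : U -> groupType) :
    (extension G N -> Prop) -> Prop :=
  fun C => exists E, C = (fun E' => ext_equiv E E').

Section FactorSystems.
Variables (U : Type) (G : groupoid U) (N : U -> groupType).

Record C1Iso := MkC1Iso {
  C1Iso_fun :> forall u v, G u v -> N v -> N u;
  C1IsoM : forall u v (x : G u v),
    {morph C1Iso_fun x : n m / n * m};
  C1Iso_bij : forall u v (x : G u v), bijective (C1Iso_fun x);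
  C1Iso1 : forall u (n : N u), C1Iso_fun (gid u) n = n
}.

Record C1 := MkC1 {
  C1_fun :> forall u v, G u v -> N u;
  C1_1 : forall u, C1_fun (gid u) = 1
}.

Record C2 := MkC2 {
  C2_fun :> forall u v w, G u v -> G v w -> N u;
  C2x1 : forall u v (x : G u v), C2_fun x (gid v) = 1;
  C21x : forall u v (x : G u v), C2_fun (gid u) x = 1
}.

Definition twisted_action (L : C1Iso) (sigma : C2) : Prop :=
  forall u v w (x : G u v) (y : G v w) (n : N w),
    L u v x (L v w y n)
    = sigma u v w x y * L u w (x ** y) n * (sigma u v w x y)^-1.

Definition twisted_cocycle (L : C1Iso) (sigma : C2) : Prop :=
  forall u v w t (x : G u v) (y : G v w) (z : G w t),
    sigma u v w x y * sigma u w t (x ** y) z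
    = L u v x (sigma v w t y z) * sigma u v t x (y ** z).

Definition factor_system (L : C1Iso) (sigma : C2) : Prop :=
  twisted_action L sigma /\ twisted_cocycle L sigma.

Lemma C1Iso_1 (L : C1Iso) u v (x : G u v) : L u v x 1 = 1.
Proof. by apply: (@mulgI _ (L u v x 1)); rewrite -C1IsoM !mulg1. Qed.

Lemma C1IsoV (L : C1Iso) u v (x : G u v) n : L u v x n^-1 = (L u v x n)^-1.
Proof.
by apply: (@mulgI _ (L u v x n)); rewrite -C1IsoM !mulgV C1Iso_1.
Qed.

Section CrossedProduct.
Variables (L : C1Iso) (sigma : C2) (LS : factor_system L sigma).

Let cp (u v : U) : Type := (N u * G u v)%type.

Definition cp_id (u : U) : cp u u := (1, gid u).

Definition cp_mul u v w (a : cp u v) (b : cp v w) : cp u w :=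
  (a.1 * L u v a.2 b.1 * sigma u v w a.2 b.2, a.2 ** b.2).

Definition cp_inv u v (a : cp u v) : cp v u :=
  ((sigma v u v (ginv a.2) a.2)^-1 * L v u (ginv a.2) a.1^-1, ginv a.2).

Lemma cp_mulA u v w t (a : cp u v) (b : cp v w) (c : cp w t) :
  cp_mul a (cp_mul b c) = cp_mul (cp_mul a b) c.
Proof.
case: a b c => [n x] [m y] [k z]; case: LS => tA tC.
rewrite /cp_mul /= gcompA; congr (_, _).
rewrite !C1IsoM tA -!mulgA; congr (_ * (_ * _)).
by rewrite -tC !mulgA mulgVK.
Qed.

Lemma cp_mul1x u v (a : cp u v) : cp_mul (cp_id u) a = a.
Proof.
by case: a => n x; rewrite /cp_mul /= gcomp1x C1Iso1 C21x mul1g mulg1.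
Qed.

Lemma cp_mulx1 u v (a : cp u v) : cp_mul a (cp_id v) = a.
Proof. by case: a => n x; rewrite /cp_mul /= gcompx1 C1Iso_1 C2x1 !mulg1. Qed.

Lemma cp_mulVx u v (a : cp u v) : cp_mul (cp_inv a) a = cp_id v.
Proof.
case: a => n x; rewrite /cp_mul /cp_inv /cp_id /= gcompVx C1IsoV.
by rewrite mulgVK mulVg.
Qed.

Lemma cp_mulxV u v (a : cp u v) : cp_mul a (cp_inv a) = cp_id u.
Proof.
case: a => n x; case: LS => tA tC.
rewrite /cp_mul /cp_inv /cp_id /= gcompxV; congr (_, _).
have E : L u v x (sigma v u v (ginv x) x) = sigma u v u x (ginv x).
  have := tC _ _ _ _ x (ginv x) x.
  by rewrite gcompxV gcompVx C21x C2x1 !mulg1.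
by rewrite C1IsoM tA gcompxV C1Iso1 C1IsoV E !mulgA !mulgVK mulgV.
Qed.

Definition cp_groupoid : groupoid U :=
  @Groupoid U cp cp_id cp_mul cp_inv
    cp_mulA cp_mul1x cp_mulx1 cp_mulVx cp_mulxV.

Definition cp_proj : groupoid_hom cp_groupoid G :=
  @GroupoidHom U cp_groupoid G (fun u v a => a.2)
    (fun u => erefl) (fun u v w a b => erefl).

Definition cp_incl u (n : N u) : cp_groupoid u u := (n, gid u).

Lemma cp_proj_surj u v (x : G u v) : exists a, cp_proj u v a = x.
Proof. by exists (1, x). Qed.

Lemma cp_inclM u (n m : N u) : cp_incl (n * m) = cp_incl n ** cp_incl m.
Proof. by rewrite /cp_incl /= /cp_mul /= C1Iso1 C2x1 mulg1 gcomp1x. Qed.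

Lemma cp_incl_inj u : injective (@cp_incl u).
Proof. by move=> n m [->]. Qed.

Lemma cp_ker u (a : cp_groupoid u u) :
  cp_proj u u a = gid u <-> exists n, cp_incl n = a.
Proof.
by case: a => n x; split=> [/= ->|[m [_ <-]] //]; exists n.
Qed.

Definition cp_ext : extension G N :=
  Extension cp_proj_surj cp_inclM cp_incl_inj cp_ker.

End CrossedProduct.

Definition outer (L : C1Iso) : Prop := exists sigma, twisted_action L sigma.

(* The class [L] : the outer L' of the form h.L *)
Definition kernel_class (L : C1Iso) : set C1Iso :=
  [set L' | outer L' /\
    exists h : C1, forall u v (x : G u v) (n : N v),
      L' u v x n = h u v x * L u v x n * (h u v x)^-1].

(* Ext(G, N)_K, for a G-kernel K *)
Definition Ext_kernel (K : set C1Iso) :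
    (extension G N -> Prop) -> Prop :=
  fun C => Ext C /\
    exists (L : C1Iso) (sigma : C2) (LS : factor_system L sigma),
      K L /\ C (cp_ext LS).

Definition central u (n : N u) : Prop := forall m : N u, commute n m.

Record cochain2 := Cochain2 {
  cochain2_fun :> C2;
  cochain2Z : forall u v w (x : G u v) (y : G v w),
    central (cochain2_fun u v w x y)
}.

Record cochain3 := Cochain3 {
  cochain3_fun :> forall u v w t, G u v -> G v w -> G w t -> N u;
  cochain3Z : forall u v w t (x : G u v) (y : G v w) (z : G w t),
    central (cochain3_fun x y z);
  cochain3_1xx : forall u w t (y : G u w) (z : G w t),
    cochain3_fun (gid u) y z = 1;
  cochain3_x1x : forall u v t (x : G u v) (z : G v t),
    cochain3_fun x (gid v) z = 1;
  cochain3_xx1 : forall u v w (x : G u v) (y : G v w),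
    cochain3_fun x y (gid w) = 1
}.

Definition d2 (L : C1Iso) (rho : cochain2) u v w t
    (x : G u v) (y : G v w) (z : G w t) : N u :=
  L u v x (rho v w t y z) * (rho u w t (x ** y) z)^-1 *
  rho u v t x (y ** z) * (rho u v w x y)^-1.

Definition d3 (L : C1Iso) (chi : cochain3) u v w t s
    (x : G u v) (y : G v w) (z : G w t) (a : G t s) : N u :=
  L u v x (chi v w t s y z a) * (chi u w t s (x ** y) z a)^-1 *
  chi u v t s x (y ** z) a * (chi u v w s x y (z ** a))^-1 *
  chi u v w t x y z.

Record cocycle3 (L : C1Iso) := Cocycle3 {
  cocycle3_fun :> cochain3;
  cocycle3P : forall u v w t s
    (x : G u v) (y : G v w) (z : G w t) (a : G t s),
    d3 L cocycle3_fun x y z a = 1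
}.

Definition coset3 (L : C1Iso) (chi : cocycle3 L) : set (cocycle3 L) :=
  [set chi' | exists rho : cochain2,
    forall u v w t (x : G u v) (y : G v w) (z : G w t),
      chi' u v w t x y z = d2 L rho x y z * chi u v w t x y z].

(* H^3(G, Z(N))_L, as the set of cosets of im d^2_L in ker d^3_L *)
Definition H3 (L : C1Iso) : Type :=
  {c : set (cocycle3 L) | exists chi, c = coset3 chi}.

Definition H3_class (L : C1Iso) (chi : cocycle3 L) : H3 L :=
  exist _ (coset3 chi) (ex_intro _ chi erefl).

Lemma central1 u : central (1 : N u).
Proof. by move=> m; apply/commute_sym/commute1. Qed.

Definition cochain3_one : cochain3 :=
  @Cochain3 (fun u v w t _ _ _ => 1) (fun u v w t _ _ _ => @central1 u)
    (fun u w t _ _ => erefl) (fun u v t _ _ => erefl) (fun u v w _ _ => erefl).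

Lemma cochain3_one_cocycle (L : C1Iso) u v w t s
    (x : G u v) (y : G v w) (z : G w t) (a : G t s) :
  d3 L cochain3_one x y z a = 1.
Proof. by rewrite /d3 /= C1Iso_1 !invg1 !mulg1. Qed.

(* The identity element of H^3(G, Z(N))_L; its coset is im d^2_L. *)
Definition H3_one (L : C1Iso) : H3 L :=
  H3_class (Cocycle3 (cochain3_one_cocycle L)).

Section CharacteristicCocycle.
Variables (L : C1Iso) (sigma : C2) (tA : twisted_action L sigma).

Definition chi_fun u v w t (x : G u v) (y : G v w) (z : G w t) : N u :=
  L u v x (sigma v w t y z) * sigma u v t x (y ** z) *
  (sigma u w t (x ** y) z)^-1 * (sigma u v w x y)^-1.

Lemma chi_funE u v w t (x : G u v) (y : G v w) (z : G w t) :
  L u v x (sigma v w t y z) * sigma u v t x (y ** z) =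
  chi_fun x y z * sigma u v w x y * sigma u w t (x ** y) z.
Proof. by rewrite /chi_fun !mulgVK. Qed.

Lemma chi_funZ u v w t (x : G u v) (y : G v w) (z : G w t) :
  central (chi_fun x y z).
Proof.
move=> m0.
set s := sigma u v w x y * sigma u w t (x ** y) z.
have Es : chi_fun x y z * s =
    L u v x (sigma v w t y z) * sigma u v t x (y ** z).
  by rewrite chi_funE mulgA.
have H k : chi_fun x y z * s * L u t (x ** y ** z) k * (chi_fun x y z * s)^-1 =
    s * L u t (x ** y ** z) k * s^-1.
  rewrite Es -gcompA.
  transitivity (L u v x (L v w y (L w t z k))).
    by rewrite (tA y z) !C1IsoM (tA x (y ** z)) C1IsoV invgM !mulgA.
  by rewrite (tA x y) (tA (x ** y) z) /s invgM !mulgA gcompA.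
clearbody s; case: (C1Iso_bij L (x ** y ** z)) => g _ gK.
have := H (g (s^-1 * m0 * s)); rewrite gK invgM !mulgA !mulgK mulgV mul1g.
by rewrite /commute => {2}<-; rewrite mulgVK.
Qed.

Lemma chi_fun_1xx u w t (y : G u w) (z : G w t) : chi_fun (gid u) y z = 1.
Proof. by rewrite /chi_fun C1Iso1 !C21x gcomp1x invg1 !mulg1 mulgV. Qed.

Lemma chi_fun_x1x u v t (x : G u v) (z : G v t) : chi_fun x (gid v) z = 1.
Proof.
by rewrite /chi_fun C21x C1Iso_1 C2x1 gcomp1x gcompx1 invg1 mul1g mulg1 mulgV.
Qed.

Lemma chi_fun_xx1 u v w (x : G u v) (y : G v w) : chi_fun x y (gid w) = 1.
Proof.
by rewrite /chi_fun !C2x1 C1Iso_1 gcompx1 invg1 mul1g mulg1 mulgV.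
Qed.

Definition chi_cochain : cochain3 :=
  Cochain3 chi_funZ chi_fun_1xx chi_fun_x1x chi_fun_xx1.

Lemma chi_cocycle u v w t s (x : G u v) (y : G v w) (z : G w t) (a : G t s) :
  d3 L chi_cochain x y z a = 1.
Proof.
have cZ u1 v1 w1 t1 (x1 : G u1 v1) (y1 : G v1 w1) (z1 : G w1 t1) m :
    chi_fun x1 y1 z1 * m = m * chi_fun x1 y1 z1 by exact: chi_funZ.
have cV u1 v1 w1 t1 (x1 : G u1 v1) (y1 : G v1 w1) (z1 : G w1 t1) m :
    (chi_fun x1 y1 z1)^-1 * m = m * (chi_fun x1 y1 z1)^-1.
  by apply/commute_sym/commuteV/commute_sym/chi_funZ.
have cE := chi_funE.
rewrite /d3 /=; move: (@chi_fun) cZ cV cE => c cZ cV cE.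
have [S ES] : exists S, S = sigma u v w x y * (sigma u w t (x ** y) z *
    sigma u t s (x ** y ** z) a) by eexists.
have E1 : L u v x (L v w y (sigma w t s z a) * sigma v w s y (z ** a)) *
    sigma u v s x (y ** (z ** a)) =
    c _ _ _ _ x y (z ** a) * c _ _ _ _ (x ** y) z a * S.
  rewrite C1IsoM -mulgA cE tA -(mulgA (c _ _ _ _ _ _ _)).
  rewrite (mulgA _ (c _ _ _ _ _ _ _)) -(cZ _ _ _ _ x y (z ** a)) -!mulgA.
  congr (_ * _).
  by rewrite mulKg cE -mulgA mulgA -cZ -mulgA ES.
have E2 : L u v x (L v w y (sigma w t s z a) * sigma v w s y (z ** a)) *
    sigma u v s x (y ** (z ** a)) =
    L u v x (c _ _ _ _ y z a) * c _ _ _ _ x (y ** z) a * c _ _ _ _ x y z * S.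
  rewrite cE !C1IsoM gcompA -!mulgA cE; congr (_ * _).
  rewrite -mulgA (mulgA _ (c _ _ _ _ _ _ _)) -(cZ _ _ _ _ x (y ** z) a).
  rewrite -mulgA; congr (_ * _).
  by rewrite (mulgA (L _ _ _ _)) cE gcompA -!mulgA ES.
have {E1 E2} E : c _ _ _ _ x y (z ** a) * c _ _ _ _ (x ** y) z a =
    L u v x (c _ _ _ _ y z a) * c _ _ _ _ x (y ** z) a * c _ _ _ _ x y z.
  by apply: (@mulIg _ S); rewrite -E1.
by rewrite -!mulgA cV cV !mulgA -E cZ mulgK mulgV.
Qed.

Definition chi_class3 : H3 L := H3_class (Cocycle3 chi_cocycle).

End CharacteristicCocycle.

(* chi(L), for a chosen sigma satisfying the twisted action condition *)
Definition char_class (L : C1Iso) (oL : outer L) : H3 L :=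
  chi_class3 (svalP (cid oL)).

End FactorSystems.

(* Main.v *)
Require Import Defs.
From mathcomp Require Import all_boot.
From mathcomp Require Import boolp classical_sets.

Set Implicit Arguments.
Unset Strict Implicit.
Unset Printing Implicit Defensive.

Local Open Scope group_scope.

(** Associativity of a crossed product is the twisted cocycle condition, and
    [chi_fun] measures its failure: a twisted action [(L, sigma)] is a factor
    system exactly when its characteristic cocycle is identically 1
    ([twisted_cocycleP]).  Two observations turn this into the theorem.

    First, for fixed [L] the maps [sigma] satisfying the twisted action
    condition form a torsor under the central 2-cochains: conjugation by
    [sigma x y] on the image of the bijection [L (x ** y)] is prescribed by [L],
    so [sigma x y] is determined up to the centre ([twisted_action_ratio]).
    Multiplying [sigma] by [rho] multiplies the characteristic cocycle by
    [d2 L rho] ([chi_fun_scale]).  Hence the cocycle of a chosen [sigma] is a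
    coboundary if and only if some [sigma'] makes [(L, sigma')] a factor system
    ([char_class_trivialP]).

    Second, an extension in the class of the kernel is given by a factor system
    for some [h.L] rather than for [L] itself.  Replacing the section
    [x |-> (1, x)] of its crossed product by [x |-> ((h x)^-1, x)] gives a factor
    system for [L] ([factor_system_untwist]).  Conversely the crossed product of
    a factor system for [L] is an extension in the class. *)

(** * Central elements *)

Section Central.
Variables (U : Type) (N : U -> groupType).

Lemma centralM u (a b : N u) : central a -> central b -> central (a * b).
Proof.
by move=> ca cb m; apply/commute_sym/commuteM; apply/commute_sym;
  [exact: ca | exact: cb].
Qed.

Lemma centralV u (a : N u) : central a -> central a^-1.
Proof. by move=> ca m; apply/commute_sym/commuteV/commute_sym/ca. Qed.

Lemma mulgACA_central u (a b p q : N u) :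
  central b -> a * p * (b * q) = a * b * (p * q).
Proof. by move=> cb; rewrite -!mulgA (mulgA p) -(cb p) -!mulgA. Qed.

Lemma mulgACA4_central u (a b c d p q r s : N u) :
  central b -> central c -> central d ->
  a * p * (b * q) * (c * r) * (d * s) = a * b * c * d * (p * q * r * s).
Proof.
move=> cb cc cd; rewrite (mulgACA_central a p q cb).
by rewrite (mulgACA_central _ _ r cc) (mulgACA_central _ _ s cd).
Qed.

Lemma invgM_central u (a p : N u) : central a -> (a * p)^-1 = a^-1 * p^-1.
Proof. by move=> ca; rewrite ca invgM. Qed.

End Central.

(** * Multiplying by central 2-cochains *)

Section CentralCochains.
Variables (U : Type) (G : groupoid U) (N : U -> groupType).
Implicit Types (L : C1Iso G N) (sigma : C2 G N) (rho : cochain2 G N).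

Lemma C2_scale_x1 rho sigma u v (x : G u v) :
  rho u v v x (gid v) * sigma u v v x (gid v) = 1.
Proof. by rewrite !C2x1 mulg1. Qed.

Lemma C2_scale_1x rho sigma u v (x : G u v) :
  rho u u v (gid u) x * sigma u u v (gid u) x = 1.
Proof. by rewrite !C21x mulg1. Qed.

Definition C2_scale rho sigma : C2 G N :=
  @MkC2 _ _ _ (fun u v w x y => rho u v w x y * sigma u v w x y)
    (C2_scale_x1 rho sigma) (C2_scale_1x rho sigma).

Lemma cochain2_mulZ rho rho' u v w (x : G u v) (y : G v w) :
  central (C2_scale rho rho' u v w x y).
Proof. by apply: centralM; exact: cochain2Z. Qed.

Definition cochain2_mul rho rho' : cochain2 G N :=
  Cochain2 (cochain2_mulZ rho rho').

Lemma C2_inv_x1 sigma u v (x : G u v) : (sigma u v v x (gid v))^-1 = 1.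
Proof. by rewrite C2x1 invg1. Qed.

Lemma C2_inv_1x sigma u v (x : G u v) : (sigma u u v (gid u) x)^-1 = 1.
Proof. by rewrite C21x invg1. Qed.

Definition C2_inv sigma : C2 G N :=
  @MkC2 _ _ _ (fun u v w x y => (sigma u v w x y)^-1)
    (C2_inv_x1 sigma) (C2_inv_1x sigma).

Definition cochain2_inv rho : cochain2 G N :=
  @Cochain2 _ _ _ (C2_inv rho) (fun u v w x y => centralV (cochain2Z rho x y)).

Definition C2_one : C2 G N :=
  @MkC2 _ _ _ (fun u v w x y => 1) (fun u v x => erefl) (fun u v x => erefl).

Definition cochain2_one : cochain2 G N :=
  @Cochain2 _ _ _ C2_one (fun u v w x y => @central1 _ N u).

Lemma d2_one L u v w t (x : G u v) (y : G v w) (z : G w t) :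
  d2 L cochain2_one x y z = 1.
Proof. by rewrite /d2 /= C1Iso_1 !invg1 !mulg1. Qed.

Lemma d2_mul L rho rho' u v w t (x : G u v) (y : G v w) (z : G w t) :
  d2 L (cochain2_mul rho rho') x y z = d2 L rho x y z * d2 L rho' x y z.
Proof.
have cZ := cochain2Z rho; rewrite /d2 /= C1IsoM !invgM_central //.
by rewrite mulgACA4_central //; apply: centralV.
Qed.

Lemma d2_inv L rho u v w t (x : G u v) (y : G v w) (z : G w t) :
  d2 L (cochain2_inv rho) x y z = (d2 L rho x y z)^-1.
Proof.
apply: (@mulIg _ (d2 L rho x y z)); rewrite -d2_mul mulVg.
by rewrite /d2 /= !mulVg C1Iso_1 !invg1 !mulg1.
Qed.

(** The values of [rho] are central, so the four factors that they contribute to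
    the left-hand side can be collected in front, where they form [d2]. *)
Lemma chi_fun_scale L rho sigma u v w t (x : G u v) (y : G v w) (z : G w t) :
  chi_fun L (C2_scale rho sigma) x y z
  = d2 L rho x y z * chi_fun L sigma x y z.
Proof.
have cZ := cochain2Z rho; rewrite /chi_fun /d2 /= C1IsoM !invgM_central //.
rewrite mulgACA4_central //; try exact: centralV.
by congr (_ * _ * _); rewrite -!mulgA (cZ _ _ _ x (y ** z)).
Qed.

Lemma twisted_action_scale L rho sigma :
  twisted_action L sigma -> twisted_action L (C2_scale rho sigma).
Proof.
move=> tA u v w x y n; rewrite tA /= invgM -!mulgA.
by rewrite [RHS]cochain2Z -!mulgA mulVg mulg1.
Qed.

End CentralCochains.

(** * Triviality of classes in H3 *)

Section Classes.
Variables (U : Type) (G : groupoid U) (N : U -> groupType) (L : C1Iso G N).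
Implicit Types chi : cocycle3 L.

Lemma H3_class_eqP chi chi' :
  H3_class chi = H3_class chi' <->
  exists rho : cochain2 G N, forall u v w t (x : G u v) (y : G v w) (z : G w t),
    chi u v w t x y z = d2 L rho x y z * chi' u v w t x y z.
Proof.
split=> [E|[rho Erho]].
  have: coset3 chi chi.
    by exists (cochain2_one G N) => u v w t x y z; rewrite d2_one mul1g.
  by have /= -> := congr1 sval E.
apply: eq_exist; apply/seteqP; split=> c [tau Ec].
  exists (cochain2_mul tau rho) => u v w t x y z.
  by rewrite Ec Erho d2_mul mulgA.
exists (cochain2_mul tau (cochain2_inv rho)) => u v w t x y z.
by rewrite Ec Erho d2_mul d2_inv mulgA mulgVK.
Qed.

(** Two maps satisfying the twisted action condition for the same [L] induce the
    same conjugation on the whole fibre, because [L (x ** y)] is onto; so their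
    ratio is central. *)
Lemma twisted_action_ratio sigma sigma' :
  twisted_action L sigma -> twisted_action L sigma' ->
  exists rho : cochain2 G N, forall u v w (x : G u v) (y : G v w),
    sigma u v w x y = rho u v w x y * sigma' u v w x y.
Proof.
move=> tA tA'.
pose r u v w (x : G u v) (y : G v w) := sigma u v w x y * (sigma' u v w x y)^-1.
have r_x1 u v (x : G u v) : r u v v x (gid v) = 1.
  by rewrite /r !C2x1 mulgV.
have r_1x u v (x : G u v) : r u u v (gid u) x = 1.
  by rewrite /r !C21x mulgV.
have rZ u v w (x : G u v) (y : G v w) : central (r u v w x y).
  move=> m; case: (C1Iso_bij L (x ** y)) => g _ gK.
  have := tA' _ _ _ x y (g ((sigma' u v w x y)^-1 * m * sigma' u v w x y)).
  rewrite tA gK => /(congr1 (fun k => k * r u v w x y)).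
  by rewrite /commute /r !mulgA !mulgVK mulgV mul1g !mulgK.
exists (@Cochain2 _ _ _ (MkC2 r_x1 r_1x) rZ) => u v w x y /=.
by rewrite /r mulgVK.
Qed.

Lemma twisted_cocycleP sigma :
  twisted_cocycle L sigma <->
  forall u v w t (x : G u v) (y : G v w) (z : G w t),
    chi_fun L sigma x y z = 1.
Proof.
split=> H u v w t x y z; last by rewrite chi_funE H mul1g.
by rewrite /chi_fun -H mulgK mulgV.
Qed.

(** A coboundary [d2 L rho] is cancelled by replacing the chosen [sigma] with
    [rho^-1 sigma]; conversely the chosen [sigma] differs from one with trivial
    cocycle by a central [rho], whose [d2] is then its cocycle. *)
Lemma char_class_trivialP (oL : outer L) :
  char_class oL = H3_one L <-> exists sigma, factor_system L sigma.
Proof.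
rewrite /char_class; case: (cid oL) => sigma tA /=.
split=> [/H3_class_eqP[rho /= Erho]|[sigma' [tA' /twisted_cocycleP chi1]]].
  exists (C2_scale (cochain2_inv rho) sigma).
  split; first exact: twisted_action_scale.
  apply/twisted_cocycleP => u v w t x y z.
  by rewrite chi_fun_scale d2_inv Erho mulg1 mulVg.
have [rho Erho] := twisted_action_ratio tA tA'.
apply/H3_class_eqP; exists rho => u v w t x y z /=.
by rewrite -(chi1 _ _ _ _ x y z) -chi_fun_scale /chi_fun /= !Erho.
Qed.

End Classes.

(** * Factor systems along a kernel class *)

Section Kernel.
Variables (U : Type) (G : groupoid U) (N : U -> groupType).
Implicit Types (L : C1Iso G N) (E : extension G N).

(** The new 2-cochain [s] is the one that the crossed product of
    [(L', sigma')] yields for the section [k x := ((h x)^-1, x)], that is,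
    [k x * k y = s x y * k (x ** y)].  Conjugation by [k x] is [L] because
    [L' = h.L], and associativity of the crossed product makes [(L, s)] a factor
    system. *)
Lemma factor_system_untwist L L' sigma' (h : C1 G N) :
  (forall u v (x : G u v) (n : N v),
     L' u v x n = h u v x * L u v x n * (h u v x)^-1) ->
  factor_system L' sigma' -> exists sigma, factor_system L sigma.
Proof.
move=> hL [tA tC].
pose s u v w (x : G u v) (y : G v w) :=
  (h u v x)^-1 * (L' u v x (h v w y)^-1 * sigma' u v w x y) * h u w (x ** y).
have s_x1 u v (x : G u v) : s u v v x (gid v) = 1.
  by rewrite /s C1_1 invg1 C1Iso_1 C2x1 gcompx1 !mulg1 mulVg.
have s_1x u v (x : G u v) : s u u v (gid u) x = 1.
  by rewrite /s C1_1 C1Iso1 C21x gcomp1x invg1 mul1g mulg1 mulVg.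
have sE u v w (x : G u v) (y : G v w) :
    h u v x * s u v w x y * (h u w (x ** y))^-1 =
    L' u v x (h v w y)^-1 * sigma' u v w x y.
  by rewrite /s -!mulgA mulVKg mulgV mulg1.
have LE u v (x : G u v) n :
    L u v x n = (h u v x)^-1 * L' u v x n * h u v x.
  by rewrite hL -!mulgA mulKg mulVg mulg1.
exists (MkC2 s_x1 s_1x); split=> [u v w x y n|u v w t x y z] /=.
  rewrite !LE /s !C1IsoM tA !C1IsoV !invgM !invgK !mulgA.
  by rewrite !mulgK.
clearbody s.
(* These outer factors complete both sides to the left-hand side of [sE], so that
   the identity becomes one in [L'] and [sigma']. *)
apply: (@mulgI _ (h u v x)); apply: (@mulIg _ (h u t (x ** y ** z))^-1).
transitivity (L' u v x (h v w y)^-1 * sigma' u v w x y *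
    (L' u w (x ** y) (h w t z)^-1 * sigma' u w t (x ** y) z)).
  by rewrite -!sE !mulgA mulgVK.
transitivity (L' u v x ((h v w y)^-1 *
    (L' v w y (h w t z)^-1 * sigma' v w t y z)) * sigma' u v t x (y ** z)).
  by rewrite !C1IsoM tA -!mulgA -tC mulKg.
by rewrite -sE !mulgA mulVg mul1g C1IsoM -!mulgA -sE hL !mulgA mulgVK gcompA.
Qed.

Lemma ext_equiv_refl E : ext_equiv E E.
Proof.
by exists (@GroupoidHom _ E E (fun _ _ e => e) (fun _ => erefl)
  (fun _ _ _ _ _ => erefl)).
Qed.

Lemma kernel_class_refl L : outer L -> kernel_class L L.
Proof.
move=> oL; split=> //.
exists (@MkC1 _ _ _ (fun u v x => 1) (fun u => erefl)) => u v x n.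
by rewrite invg1 mulg1 mul1g.
Qed.

Lemma Ext_kernel_nonemptyP L : outer L ->
  (exists C : extension G N -> Prop, Ext_kernel (kernel_class L) C) <->
  exists sigma, factor_system L sigma.
Proof.
move=> oL; split.
  by move=> [C [_ [L' [sigma' [LS' [[_ [h hL]] _]]]]]];
    exact: factor_system_untwist hL LS'.
move=> [sigma LS]; exists (ext_equiv (cp_ext LS)).
split; first by exists (cp_ext LS).
exists L, sigma, LS; split; first exact: kernel_class_refl.
exact: ext_equiv_refl.
Qed.

End Kernel.

Theorem corollary3p25 (U : Type) (G : groupoid U) (N : U -> groupType)
    (L : C1Iso G N) (oL : outer L) :
  (exists C : extension G N -> Prop, Ext_kernel (kernel_class L) C) <->
  char_class oL = H3_one L.
Proof.
exact: iff_trans (Ext_kernel_nonemptyP oL) (iff_sym (char_class_trivialP oL)).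
Qed.
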